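(* Let $\mathcal B=[f_1^{\mathrm{lo}},f_1^{\mathrm{up}}]\times[f_2^{\mathrm{lo}},f_2^{\mathrm{up}}]\times[\Upsilon^{\mathrm{lo}},\Upsilon^{\mathrm{up}}]\times[\theta^{\mathrm{lo}},\theta^{\mathrm{up}}]$ with $\theta^{\mathrm{lo}}<\theta^{\mathrm{up}}$, and $S=\{(f,\Upsilon,\theta)\in\mathcal B\mid \frac{\alpha_1f_1}{\alpha_1-\theta}-\frac{\alpha_2f_2}{\theta-\alpha_2}\le\Upsilon\}$. Let $\underline{\Upsilon\theta}$, $H_i$, $\underline{H\theta}_i$ ($i=1,2$) be real variables (linearizations of $\Upsilon\cdot\theta$, $\frac{f_i}{|\alpha_i-\theta|}$ and $\frac{f_i\theta}{|\alpha_i-\theta|}$, respectively). Define $$S_{\mathrm{std}}=\{(f,\Upsilon,\theta,H)\in\mathcal B\times\mathbb R^2\mid \alpha_1H_1-\alpha_2H_2\le\Upsilon,\ \check H_i\le H_i\le\hat H_i,\ i=1,2\}.$$ For $C\subseteq\mathcal B\times\mathbb R^5$ let $S_{\mathrm{RLT}}$ be the set of $(f,\Upsilon,\theta,H,\underline{H\theta},\underline{\Upsilon\theta})\in C$ satisfying $$\alpha_1(\underline{H\theta}_1-\theta^{\mathrm{lo}}H_1)-\alpha_2(\underline{H\theta}_2-\theta^{\mathrm{lo}}H_2)\le\underline{\Upsilon\theta}-\Upsilon\theta^{\mathrm{lo}},$$ $$\alpha_1(\theta^{\mathrm{up}}H_1-\underline{H\theta}_1)-\alpha_2(\theta^{\mathrm{up}}H_2-\underline{H\theta}_2)\le\Upsilon\theta^{\mathrm{up}}-\underline{\Upsilon\theta}.$$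 For $C'\subseteq\mathcal B\times\mathbb R^3$ let $S_{\mathrm{RDLT}}$ be the set of $(f,\Upsilon,\theta,H,\underline{\Upsilon\theta})\in C'$ satisfying $$\alpha_1(\alpha_1H_1-f_1-\theta^{\mathrm{lo}}H_1)-\alpha_2(\alpha_2H_2+f_2-\theta^{\mathrm{lo}}H_2)\le\underline{\Upsilon\theta}-\Upsilon\theta^{\mathrm{lo}},$$ $$\alpha_1(\theta^{\mathrm{up}}H_1-\alpha_1H_1+f_1)-\alpha_2(\theta^{\mathrm{up}}H_2-f_2-\alpha_2H_2)\le\Upsilon\theta^{\mathrm{up}}-\underline{\Upsilon\theta}.$$ Assume that $$C\supseteq\{(f,\Upsilon,\theta,H,\underline{H\theta},\underline{\Upsilon\theta})\mid(f,\Upsilon,\theta,H,\underline{\Upsilon\theta})\in C',\ \underline{H\theta}_1=\alpha_1H_1-f_1,\ \underline{H\theta}_2=\alpha_2H_2+f_2\}$$ and that $\operatorname{proj}_{(H_1,H_2)}C\subseteq[\check H_1,\hat H_1]\times[\check H_2,\hat H_2]$. Then $$S_{\mathrm{std}}\supseteq\operatorname{proj}_{(f,\Upsilon,\theta,H)}(S_{\mathrm{RLT}})$$ and $$S_{\mathrm{RLT}}\supseteq\{(f,\Upsilon,\theta,H,\underline{H\theta},\underline{\Upsilon\theta})\mid(f,\Upsilon,\theta,H,\underline{\Upsilon\theta})\in S_{\mathrm{RDLT}},\ \underline{H\theta}_1=\alpha_1H_1-f_1,\ \underline{H\theta}_2=\alpha_2H_2+f_2\},$$ the right-hand side being an affine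 lifting of $S_{\mathrm{RDLT}}$.
   Context: $0<\alpha_2<\alpha_1$ are real constants (relative volatilities); $f=(f_1,f_2)$, $H=(H_1,H_2)$, $\underline{H\theta}=(\underline{H\theta}_1,\underline{H\theta}_2)$. The superscripts lo and up denote given real lower and upper bounds; $\check H_i\le\hat H_i$ are given real constants (bounds for $H_i$). An underlined concatenation such as $\underline{\Upsilon\theta}$ denotes a single variable. $\operatorname{proj}_{(\cdot)}$ denotes projection onto the indicated coordinates. *)

(* Defs.v *)
From HB Require Import structures.
From mathcomp Require Import all_boot all_order all_algebra.
From mathcomp Require Import all_classical all_reals.

Set Implicit Arguments.
Unset Strict Implicit.
Unset Printing Implicit Defensive.

Import Order.TTheory GRing.Theory Num.Theory.

Local Open Scope classical_set_scope.
Local Open Scope ring_scope.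

(* [R^o] is [R] seen as a module over itself, so that the product types below
   are vector spaces over [R]. *)
Notation vec2 R := (R^o * R^o)%type.

(* (f, Upsilon, theta) *)
Notation base_point R := (vec2 R * R^o * R^o)%type.

(* (f, Upsilon, theta), H *)
Notation std_point R := (base_point R * vec2 R)%type.

(* (f, Upsilon, theta), (H, Htheta, Upsilontheta) *)
Notation rlt_point R := (base_point R * (vec2 R * vec2 R * R^o))%type.

(* (f, Upsilon, theta), (H, Upsilontheta) *)
Notation rdlt_point R := (base_point R * (vec2 R * R^o))%type.

Definition rect2 (R : realType) (lo up : vec2 R) : set (vec2 R) :=
  `[lo.1 : R, up.1 : R] `*` `[lo.2 : R, up.2 : R].

Definition box (R : realType) (flo fup : vec2 R) (Ulo Uup tlo tup : R) :
    set (base_point R) :=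
  rect2 flo fup `*` `[Ulo, Uup] `*` `[tlo, tup].

(* The nonlinear set whose relaxations are compared; the comparison itself
   does not refer to it. The disequalities are the domain of definition of the
   two fractions, as [x / 0] is [0] in a field here. *)
Definition S_set (R : realType) (a1 a2 : R) (B : set (base_point R)) :
    set (base_point R) :=
  [set p | B p /\ let: (f, U, t) := p in
    [/\ t != a1, t != a2 &
        a1 * f.1 / (a1 - t) - a2 * f.2 / (t - a2) <= U]].

Definition S_std (R : realType) (a1 a2 : R) (B : set (base_point R))
    (Hlo Hup : vec2 R) : set (std_point R) :=
  [set p | (B `*` setT) p /\ let: ((f, U, t), H) := p in
    [/\ a1 * H.1 - a2 * H.2 <= U,
        Hlo.1 <= H.1 <= Hup.1 &
        Hlo.2 <= H.2 <= Hup.2]].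

Definition S_RLT (R : realType) (a1 a2 tlo tup : R) (C : set (rlt_point R)) :
    set (rlt_point R) :=
  [set p | C p /\ let: ((f, U, t), (H, HT, UT)) := p in
    a1 * (HT.1 - tlo * H.1) - a2 * (HT.2 - tlo * H.2) <= UT - U * tlo /\
    a1 * (tup * H.1 - HT.1) - a2 * (tup * H.2 - HT.2) <= U * tup - UT].

Definition S_RDLT (R : realType) (a1 a2 tlo tup : R) (C' : set (rdlt_point R)) :
    set (rdlt_point R) :=
  [set p | C' p /\ let: ((f, U, t), (H, UT)) := p in
    a1 * (a1 * H.1 - f.1 - tlo * H.1) - a2 * (a2 * H.2 + f.2 - tlo * H.2)
      <= UT - U * tlo /\
    a1 * (tup * H.1 - a1 * H.1 + f.1) - a2 * (tup * H.2 - f.2 - a2 * H.2)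
      <= U * tup - UT].

Definition proj_std (R : realType) (p : rlt_point R) : std_point R :=
  let: (b, (H, HT, UT)) := p in (b, H).

Definition proj_H (R : realType) (p : rlt_point R) : vec2 R :=
  let: (b, (H, HT, UT)) := p in H.

Definition proj_rdlt (R : realType) (p : rlt_point R) : rdlt_point R :=
  let: (b, (H, HT, UT)) := p in (b, (H, UT)).

Definition rdlt_lift (R : realType) (a1 a2 : R) (A : set (rdlt_point R)) :
    set (rlt_point R) :=
  [set p | let: ((f, U, t), (H, HT, UT)) := p in
    [/\ A ((f, U, t), (H, UT)),
        HT.1 = a1 * H.1 - f.1 &
        HT.2 = a2 * H.2 + f.2]].

Definition affine_map (R : realType) (V W : lmodType R) (L : V -> W) : Prop :=
  exists (g : {linear V -> W}) (b : W), forall x, L x = g x + b.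

(* [B], in a space mapped to that of [A] by [pi], is the image of [A] under an
   affine section of [pi]. *)
Definition affine_lifting (R : realType) (V W : lmodType R) (pi : W -> V)
    (A : set V) (B : set W) : Prop :=
  exists L : V -> W, [/\ affine_map L, cancel L pi & B = L @` A].

(* Main.v *)
Require Import Defs.
From HB Require Import structures.
From mathcomp Require Import all_boot all_order all_algebra.
From mathcomp Require Import all_classical all_reals.
From mathcomp Require Import ring lra.

Import Order.TTheory GRing.Theory Num.Theory.

Local Open Scope classical_set_scope.
Local Open Scope ring_scope.

(** The sum of the two RLT inequalities no longer contains [HT] and [UT]: it is the inequality of
    [S_std] times [tup - tlo > 0] ([S_RLT_linear]). Substituting the values of [HT] that define the
    lift turns the RLT inequalities into the RDLT ones, which gives the second inclusion
    ([rdlt_lift_S_RDLT]). These values are linear in [f] and [H], so the lift is the image of a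
    linear section of [proj_rdlt]. *)

(** For [a2 < t < a1], clearing denominators in [H1 = f1 / (a1 - t)] and [H2 = f2 / (t - a2)] gives
    [H1 * t = a1 * H1 - f1] and [H2 * t = a2 * H2 + f2]. *)
Definition lift_point (R : realType) (a1 a2 : R) (p : rdlt_point R) :
    rlt_point R :=
  (p.1, (p.2.1,
    (a1 * p.2.1.1 - p.1.1.1.1, a2 * p.2.1.2 + p.1.1.1.2) : vec2 R, p.2.2)).

Lemma lift_point_is_linear (R : realType) (a1 a2 : R) :
  linear (lift_point R a1 a2).
Proof.
move=> k [[[[f1 f2] U] t] [[H1 H2] UT]] [[[[g1 g2] V] s] [[K1 K2] VT]].
rewrite /lift_point /=.
(* Scaling on [R^o] is unfolded to multiplication for [ring]. *)
by congr (_, (_, (_, _), _)) => /=; rewrite /GRing.scale /=; ring.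
Qed.

HB.instance Definition _ (R : realType) (a1 a2 : R) :=
  GRing.isLinear.Build R (rdlt_point R) (rlt_point R) _ (lift_point R a1 a2)
    (lift_point_is_linear R a1 a2).

Lemma rdlt_lift_image (R : realType) (a1 a2 : R) (A : set (rdlt_point R)) :
  rdlt_lift a1 a2 A = lift_point R a1 a2 @` A.
Proof.
apply/seteqP; split.
  move=> [[[f U] t] [[H [HT1 HT2]] UT]] /= [Ap -> ->].
  by exists ((f, U, t), (H, UT)).
by move=> _ [[[[f U] t] [H UT]] Ap <-].
Qed.

Lemma affine_lifting_rdlt_lift (R : realType) (a1 a2 : R)
    (A : set (rdlt_point R)) :
  affine_lifting (@proj_rdlt R) A (rdlt_lift a1 a2 A).
Proof.
exists (lift_point R a1 a2); split; last exact: rdlt_lift_image.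
  by exists (lift_point R a1 a2), 0 => p; rewrite addr0.
by move=> [b [H UT]].
Qed.

Lemma rdlt_lift_S_RDLT (R : realType) (a1 a2 tlo tup : R)
    (C : set (rlt_point R)) (C' : set (rdlt_point R)) :
  rdlt_lift a1 a2 C' `<=` C ->
  rdlt_lift a1 a2 (S_RDLT a1 a2 tlo tup C') `<=` S_RLT a1 a2 tlo tup C.
Proof.
move=> liftC [[[f U] t] [[H HT] UT]] /= [[C'p [lo_le up_le]] HT1 HT2].
split; first exact: liftC.
rewrite HT1 HT2; split=> //.
(* The lower inequality already matches verbatim; the upper one differs by expanding
   [tup * H - HT]. *)
lra.
Qed.

(* Adding the two RLT inequalities cancels the linearized products and leaves
   the original inequality multiplied by [tup - tlo]. *)
Lemma S_RLT_linear (R : realType) (a1 a2 tlo tup U UT H1 H2 HT1 HT2 : R) :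
  tlo < tup ->
  a1 * (HT1 - tlo * H1) - a2 * (HT2 - tlo * H2) <= UT - U * tlo ->
  a1 * (tup * H1 - HT1) - a2 * (tup * H2 - HT2) <= U * tup - UT ->
  a1 * H1 - a2 * H2 <= U.
Proof.
rewrite -subr_gt0 => t_gt0 lo_le up_le; rewrite -(ler_pM2l t_gt0); lra.
Qed.

Theorem proposition8 (R : realType) (a1 a2 : R)
    (flo fup : vec2 R) (Ulo Uup tlo tup : R) (Hlo Hup : vec2 R)
    (C : set (rlt_point R)) (C' : set (rdlt_point R))
    (B := box flo fup Ulo Uup tlo tup) :
  0 < a2 -> a2 < a1 ->
  tlo < tup ->
  Hlo.1 <= Hup.1 -> Hlo.2 <= Hup.2 ->
  C `<=` B `*` setT ->
  C' `<=` B `*` setT ->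
  rdlt_lift a1 a2 C' `<=` C ->
  (@proj_H R) @` C `<=` rect2 Hlo Hup ->
  [/\ (@proj_std R) @` S_RLT a1 a2 tlo tup C `<=` S_std a1 a2 B Hlo Hup,
      rdlt_lift a1 a2 (S_RDLT a1 a2 tlo tup C') `<=` S_RLT a1 a2 tlo tup C &
      affine_lifting (@proj_rdlt R) (S_RDLT a1 a2 tlo tup C')
        (rdlt_lift a1 a2 (S_RDLT a1 a2 tlo tup C'))].
Proof.
move=> _ _ lt_t _ _ CB _ liftC projC; split.
- move=> _ [[[[f U] t] [[H HT] UT]] [Cp [lo_le up_le]] <-].
  (* The bounds on [H] come from the projection of [C], not from the RLT inequalities. *)
  have [H1_bnd H2_bnd] : rect2 Hlo Hup H.
    by apply: projC; exists ((f, U, t), (H, HT, UT)).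
  split; first by have [] := CB _ Cp.
  split; last 2 first.
  + by move: H1_bnd; rewrite /= in_itv.
  + by move: H2_bnd; rewrite /= in_itv.
  exact: S_RLT_linear lt_t lo_le up_le.
- exact: rdlt_lift_S_RDLT.
- exact: affine_lifting_rdlt_lift.
Qed.
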